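(* Let $q \ge 2$ be a prime power, let $(\varepsilon_d : d \in \mathcal{D}_q)$ be a probability vector indexed by the set $\mathcal{D}_q$ of positive divisors of $q$, let $V = V_{(q)}(\varepsilon_d : d \in \mathcal{D}_q)$ be the associated generalized erasure channel, let $\gamma \in \mathbb{Z}_q$ with $\gcd(\gamma,q)=1$, and let $V^0, V^1$ be the channels obtained from $V$ by the one-step polar transformation with parameter $\gamma$. Then $$I_\alpha(V^0) + I_\alpha(V^1) \ge 2 I_\alpha(V) \quad \text{for } 0 \le \alpha \le 1,$$ $$I_\alpha(V^0) + I_\alpha(V^1) \le 2 I_\alpha(V) \quad \text{for } 1 \le \alpha \le \infty.$$
   Context: **Channels.** $\mathbb{Z}_q = \{0,1,\dots,q-1\}$. A channel $W : \mathbb{Z}_q \to \mathcal{Y}$ with finite output alphabet $\mathcal{Y}$ is a family of conditional probabilities $W(y \mid x)$. **Symmetric capacity of order $\alpha$.** For $\alpha \in (0,1)\cup(1,\infty)$, $$I_\alpha(W) = \frac{\alpha}{\alpha-1} \ln \Bigg[ \sum_{y \in \mathcal{Y}} \Big( \sum_{x \in \mathbb{Z}_q} \tfrac{1}{q} W(y \mid x)^\alpha \Big)^{1/\alpha} \Bigg],$$ and for $\alpha\in\{0,1,\infty\}$ it is defined by limits: $I_0(W) = \lim_{\alpha\to 0^+} I_\alpha(W) = \min_{y} \ln \frac{q}{|\{x \in \mathbb{Z}_q : W(y\mid x) > 0\}|}$ (outputs $y$ with $W(y\mid x)=0$ for all $x$ are ignored), $I_1(W) = \lim_{\alpha \to 1}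 I_\alpha(W) = \sum_{y}\sum_{x} \frac1q W(y\mid x) \ln \frac{W(y\mid x)}{\sum_{x'} \frac1q W(y \mid x')}$, $I_\infty(W) = \lim_{\alpha\to\infty} I_\alpha(W) = \ln \sum_{y} \max_{x} W(y\mid x)$. **Polar transformation.** For $\gamma \in \mathbb{Z}_q$ with $\gcd(\gamma,q)=1$ put $f_\gamma(u_1,u_2) = u_1 + \gamma u_2 \bmod q \in \mathbb{Z}_q$. The one-step polar transformation with parameter $\gamma$ maps $W : \mathbb{Z}_q \to \mathcal{Y}$ to the channels $W^0 : \mathbb{Z}_q \to \mathcal{Y}^2$ and $W^1 : \mathbb{Z}_q \to \mathcal{Y}^2 \times \mathbb{Z}_q$, $$W^0(y_1,y_2 \mid u_1) = \sum_{u_2 \in \mathbb{Z}_q} \tfrac1q W(y_1 \mid f_\gamma(u_1,u_2)) W(y_2 \mid u_2),$$ $$W^1(y_1,y_2,u_1 \mid u_2) = \tfrac1q W(y_1 \mid f_\gamma(u_1,u_2)) W(y_2 \mid u_2).$$ **Generalized erasure channel.** $\mathcal{D}_q$ is the set of positive divisors of $q$. For $d \in \mathbb{N}$ and $r \in \mathbb{Z}$, $[r]_d = \{ z \in \mathbb{Z} : z \equiv r \pmod d\}$ and $\mathbb{Z}/d\mathbb{Z} = \{[r]_d : r \in \mathbb{Z}\}$. Given $\varepsilon_d \ge 0$ ($d\in\mathcal{D}_q$) with $\sum_{d \in \mathcal{D}_q} \varepsilon_d = 1$, the channel $V_{(q)}(\varepsilon_d : d \in \mathcal{D}_q)$ has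 input alphabet $\mathbb{Z}_q$, output alphabet $\mathcal{Y} = \bigcup_{d \in \mathcal{D}_q} (\mathbb{Z}/d\mathbb{Z})$ (a disjoint union), and transition probabilities $V(y \mid x) = \varepsilon_d$ if $y = [x]_d$ for some $d \in \mathcal{D}_q$, and $V(y\mid x) = 0$ otherwise. *)

(* Defs.v *)
From mathcomp Require Import all_boot all_order all_algebra.
From mathcomp Require Import all_classical all_reals all_analysis.

Set Implicit Arguments.
Unset Strict Implicit.
Unset Printing Implicit Defensive.

Import Order.TTheory GRing.Theory Num.Theory.
Import numFieldNormedType.Exports.

Local Open Scope classical_set_scope.
Local Open Scope ring_scope.

(* [W x y] is the conditional probability W(y | x). *)
Record channel (R : realType) (q : nat) (Y : finType) := Channel {
  trans :> 'I_q -> Y -> R;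
  trans_ge0 : forall x y, 0 <= trans x y;
  trans_sum1 : forall x, \sum_(y : Y) trans x y = 1
}.

Definition capacity_gen (R : realType) (q : nat) (Y : finType)
    (W : channel R q Y) (a : R) : R :=
  a / (a - 1) *
  ln (\sum_(y : Y) (\sum_(x < q) q%:R^-1 * W x y `^ a) `^ a^-1).

(* The symmetric capacity of order [alpha] in [0, +oo]; the orders 0, 1 and +oo
   are limits of the other ones.  Negative orders are never used: they get the
   value of the same formula, and -oo gets 0. *)
Definition capacity (R : realType) (q : nat) (Y : finType)
    (alpha : \bar R) (W : channel R q Y) : R :=
  match alpha with
  | a%:E => if a == 0 then lim (capacity_gen W b @[b --> (0 : R)^'+])
            else if a == 1 then lim (capacity_gen W b @[b --> (1 : R)^'])
            else capacity_gen W a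
  | +oo%E => lim (capacity_gen W b @[b --> +oo%R])
  | -oo%E => 0
  end.

(* The proof argument only provides 0 < q, from the inhabitant [u1] of 'I_q. *)
Definition polar_map (q : nat) (g u1 u2 : 'I_q) : 'I_q :=
  Ordinal (ltn_pmod (u1 + g * u2) (leq_ltn_trans (leq0n u1) (ltn_ord u1))).

Section PolarTransformation.
Variables (R : realType) (q : nat) (Y : finType).
Variables (g : 'I_q) (W : channel R q Y).

Definition polar0_fun (u1 : 'I_q) (y : Y * Y) : R :=
  \sum_(u2 < q) q%:R^-1 * W (polar_map g u1 u2) y.1 * W u2 y.2.

Definition polar1_fun (u2 : 'I_q) (y : Y * Y * 'I_q) : R :=
  q%:R^-1 * W (polar_map g y.2 u2) y.1.1 * W u2 y.1.2.

Lemma sum_uniform (x : 'I_q) : \sum_(u < q) q%:R^-1 = 1 :> R.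
Proof.
rewrite sumr_const card_ord -[LHS]mulr_natr mulVf // pnatr_eq0 -lt0n.
exact: leq_ltn_trans (ltn_ord x).
Qed.

Lemma sum_trans_pair (c : R) (x x' : 'I_q) :
  \sum_(y : Y * Y) c * W x y.1 * W x' y.2 = c.
Proof.
rewrite -(pair_bigA _ (fun y1 y2 => c * W x y1 * W x' y2)) /=.
under eq_bigr do rewrite -mulr_sumr trans_sum1 mulr1.
by rewrite -mulr_sumr trans_sum1 mulr1.
Qed.

Lemma polar0_ge0 u1 y : 0 <= polar0_fun u1 y.
Proof.
by apply: sumr_ge0 => u2 _; rewrite !mulr_ge0 ?invr_ge0 ?ler0n ?trans_ge0.
Qed.

Lemma polar0_sum1 u1 : \sum_y polar0_fun u1 y = 1.
Proof.
rewrite exchange_big /=; under eq_bigr do rewrite sum_trans_pair.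
exact: sum_uniform.
Qed.

Lemma polar1_ge0 u2 y : 0 <= polar1_fun u2 y.
Proof. by rewrite !mulr_ge0 ?invr_ge0 ?ler0n ?trans_ge0. Qed.

Lemma polar1_sum1 u2 : \sum_y polar1_fun u2 y = 1.
Proof.
rewrite -(pair_bigA _ (fun y u1 => polar1_fun u2 (y, u1))) exchange_big /=.
under eq_bigr do rewrite /polar1_fun /= sum_trans_pair.
exact: sum_uniform.
Qed.

Definition polar0 : channel R q (Y * Y)%type := Channel polar0_ge0 polar0_sum1.

Definition polar1 : channel R q (Y * Y * 'I_q)%type :=
  Channel polar1_ge0 polar1_sum1.

End PolarTransformation.

Definition divisor (q : nat) : finType := seq_sub (divisors q).

(* The disjoint union of the Z/dZ over the divisors d of q; the class [r]_d is
   represented by its least nonnegative element r %% d : 'I_d. *)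
Definition gec_output (q : nat) : finType := {d : divisor q & 'I_(ssval d)}.

Section GeneralizedErasureChannel.
Variables (R : realType) (q : nat) (eps : divisor q -> R).

Definition gec_fun (x : 'I_q) (y : gec_output q) : R :=
  if (tagged y == x %% ssval (tag y) :> nat)%N then eps (tag y) else 0.

Hypothesis eps_ge0 : forall d, 0 <= eps d.
Hypothesis eps_sum1 : \sum_(d : divisor q) eps d = 1.

Lemma gec_ge0 x y : 0 <= gec_fun x y.
Proof. by rewrite /gec_fun; case: ifP. Qed.

Lemma gec_sum1 x : \sum_y gec_fun x y = 1.
Proof.
rewrite -eps_sum1.
transitivity (\sum_(d : divisor q) \sum_(r < ssval d)
    gec_fun x (Tagged (fun d : divisor q => 'I_(ssval d)) r)).
  by rewrite sig_big_dep; apply: eq_bigr => -[].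
apply: eq_bigr => d _.
have q_gt0 : (0 < q)%N by apply: leq_ltn_trans (ltn_ord x).
have d_gt0 : (0 < ssval d)%N.
  by have := ssvalP d; rewrite -dvdn_divisors // => /dvdn_gt0; apply.
rewrite (bigD1 (Ordinal (ltn_pmod x d_gt0))) //= big1 => [|r].
  by rewrite /gec_fun /= eqxx addr0.
by rewrite -val_eqE /gec_fun /= => /negPf ->.
Qed.

Definition gec : channel R q (gec_output q) := Channel gec_ge0 gec_sum1.

End GeneralizedErasureChannel.

(* Main.v *)
(* With t = 1 - 1/alpha, each of the three capacities of order alpha has the
   form t^-1 * ln S(t) for a power sum S: sum_d eps_d d^t for V,
   sum_(d, d') eps_d eps_d' gcd(d, d')^t for V^0, and the same sum with lcm for
   V^1.  The divisors of a prime power form a chain, so gcd and lcm are the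
   minimum and the maximum of d and d', whence S0 + S1 = 2 S.  By AM-GM,
   S0 * S1 <= S^2, and the sign of t is that of alpha - 1.  The orders 0, 1 and
   +oo correspond to t tending to -oo, 0 and 1, where t^-1 * ln S(t)
   converges. *)
Require Import Defs.
From mathcomp Require Import all_boot all_order all_algebra.
From mathcomp Require Import all_classical all_reals all_analysis.
From mathcomp Require Import ring lra.

Set Implicit Arguments.
Unset Strict Implicit.
Unset Printing Implicit Defensive.

Import Order.TTheory GRing.Theory Num.Theory.
Import numFieldNormedType.Exports.

Local Open Scope ring_scope.

(** * Counting solutions of affine congruences *)

Section Counting.
Local Open Scope nat_scope.

Lemma eqn_modMl_coprime d g u v : coprime g d ->
  (g * u == g * v %[mod d]) = (u == v %[mod d]).
Proof.
move=> gd; wlog le_uv : u v / u <= v => [th|].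
  by case/orP: (leq_total u v) => /th // e; rewrite eq_sym e eq_sym.
rewrite [LHS]eq_sym [RHS]eq_sym !eqn_mod_dvd ?leq_mul // -mulnBr.
by rewrite Gauss_dvdr // coprime_sym.
Qed.

(** Since [g] is invertible modulo [d], the map sending [u] to [s + g * u] permutes the residues, so
    each [r] is hit exactly once. *)
Lemma card_affine_mod_period d g s r : 0 < d -> coprime g d ->
  \sum_(u < d) (s + g * u == r %[mod d]) = 1.
Proof.
move=> d_gt0 gd.
pose f (u : 'I_d) : 'I_d := Ordinal (ltn_pmod (s + g * u) d_gt0).
have f_inj : injective f.
  move=> u v /(congr1 val) /= /eqP; rewrite eqn_modDl eqn_modMl_coprime //.
  by rewrite !modn_small // => /eqP/val_inj.
have [h fK hK] := injF_bij f_inj.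
rewrite (bigD1 (h (Ordinal (ltn_pmod r d_gt0)))) //= big1 => [|u].
  have /(congr1 val) /= -> := hK (Ordinal (ltn_pmod r d_gt0)).
  by rewrite eqxx.
apply: contraNeq; rewrite eqb0 negbK => /eqP e.
by apply/eqP; rewrite -[LHS]fK; congr h; apply: val_inj.
Qed.

(** The range below [q] splits into [q %/ d] blocks of length [d], each containing one solution. *)
Lemma card_affine_mod q d g s r : 0 < q -> d %| q -> coprime g d ->
  \sum_(u < q) (s + g * u == r %[mod d]) = q %/ d.
Proof.
move=> q_gt0 /dvdnP[k qE] gd; move: q_gt0; rewrite {}qE muln_gt0.
case/andP=> _ d_gt0; rewrite mulnK //.
rewrite -(big_mkord xpredT (fun u => nat_of_bool (s + g * u == r %[mod d]))).
rewrite big_nat_mul /= -[RHS]muln1 -[X in X * 1]subn0 -sum_nat_const_nat.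
apply: eq_bigr => i _.
rewrite mulSn -{1}[i * d]add0n big_addn addnK big_mkord.
rewrite -(card_affine_mod_period s r d_gt0 gd); apply: eq_bigr => u _.
by rewrite mulnDr mulnA addnA addnC modnMDl.
Qed.

End Counting.

(** * Weighted power sums and limits of their scaled logarithms *)

Section PowerSums.
Local Open Scope classical_set_scope.
Variables (R : realType) (I : finType) (w c : I -> R).
Hypothesis w_ge0 : forall i, 0 <= w i.
Hypothesis w_sum1 : \sum_i w i = 1.
Hypothesis c_gt0 : forall i, 0 < c i.

Definition power_sum (t : R) : R := \sum_i w i * c i `^ t.

Lemma exists_weight_gt0 : exists i, 0 < w i.
Proof.
apply: contrapT => /forallNP w_le0; suff: \sum_i w i = 0 :> R.
  by rewrite w_sum1 => /eqP; rewrite oner_eq0.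
apply: big1 => i _; apply/eqP; rewrite eq_le w_ge0 andbT leNgt.
exact/negP/w_le0.
Qed.

Lemma power_sum_gt0 t : 0 < power_sum t.
Proof.
have [i wi_gt0] := exists_weight_gt0.
rewrite /power_sum (bigD1 i) //= ltr_pwDl ?mulr_gt0 ?powR_gt0 //.
by apply: sumr_ge0 => j _; rewrite mulr_ge0 ?powR_ge0.
Qed.

Lemma power_sum0 : power_sum 0 = 1.
Proof. by rewrite -[RHS]w_sum1; apply: eq_bigr => i _; rewrite powRr0 mulr1. Qed.

Lemma derivable_power_sum t : derivable power_sum t 1.
Proof.
(* As the bases are positive, each power is an exponential in [s]; enumerating [I] gives a sum of
   functions indexed by ordinals. *)
have -> : power_sum = \sum_(i < #|I|)
    (fun s => w (enum_val i) *: expR (s * ln (c (enum_val i)))).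
  apply/funext => s; rewrite fct_sumE /power_sum (reindex (@enum_val I predT)) /=.
    by apply: eq_bigr => i _; rewrite /powR gt_eqF.
  exact/onW_bij/enum_val_bij.
apply: derivable_sum => i.
apply: derivableZ; apply/derivable1_diffP.
apply: differentiable_comp => //.
by apply/derivable1_diffP; apply: derivable_expR.
Qed.

Lemma derivable_ln_power_sum t : derivable (fun s => ln (power_sum s)) t 1.
Proof.
apply/derivable1_diffP; apply: differentiable_comp.
  exact/derivable1_diffP/derivable_power_sum.
by have [+ _] := is_derive1_ln (power_sum_gt0 t); move/derivable1_diffP.
Qed.

(** The logarithm of the weighted power mean of order [t]. At [t = 0] it takes the value 0, because
    [0^-1 = 0], and not its limit. *)
Definition scaled_log (t : R) : R := t^-1 * ln (power_sum t).

(** As [power_sum 0 = 1], [scaled_log] is the difference quotient at 0 of [ln (power_sum t)], which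
    is derivable there. *)
Lemma cvg_scaled_log0 : cvg (scaled_log t @[t --> (0 : R)^']).
Proof.
have := @derivable_ln_power_sum 0; rewrite /derivable.
rewrite power_sum0 ln1; suff -> : scaled_log =
  (fun h => h^-1 *: (((fun s => ln (power_sum s)) \o shift 0) h%:A - 0)) by [].
by apply/funext => t /=; rewrite subr0 addr0 [_ *: 1]mulr1.
Qed.

Lemma cvg_scaled_log1 : cvg (scaled_log t @[t --> (1 : R)]).
Proof.
apply/cvg_ex; exists (1^-1 * ln (power_sum 1)); apply: cvgM.
  by apply: cvgV; [exact: oner_neq0 | exact: cvg_id].
have /derivable1_diffP := @derivable_ln_power_sum 1.
exact: differentiable_continuous.
Qed.

(** The power mean tends to the least [c i] among the indices of positive weight; its logarithm is
    squeezed between [ln (c i0)] and [ln (c i0) + t^-1 * ln (w i0)]. *)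
Lemma cvg_scaled_logNy : cvg (scaled_log t @[t --> -oo%R]).
Proof.
have [i1 wi1] := exists_weight_gt0.
have [i0 wi0 c_min] : exists2 i0, 0 < w i0 & forall i, 0 < w i -> c i0 <= c i.
  by case: (@arg_minP _ _ _ i1 (fun i => 0 < w i) c wi1) => i0; exists i0.
apply/cvg_ex; exists (ln (c i0)).
apply: (@squeeze_cvgr _ _ _ _ (cst (ln (c i0)))
          (fun t => ln (c i0) + t^-1 * ln (w i0))); last 2 first.
- exact: cvg_cst.
- rewrite -[X in _ --> X]addr0 -[X in _ + X](mul0r (ln (w i0))).
  apply: cvgD; first exact: cvg_cst.
  apply: cvgM; last exact: cvg_cst.
  by apply/ltr0_cvgV0; [exact: nbhs_ninfty_lt | exact: cvg_id].
near=> t.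
have t_lt0 : t < 0 by near: t; exact: nbhs_ninfty_lt.
rewrite /cst /scaled_log; apply/andP; split.
  rewrite ler_ndivlMl // -ln_powR ler_ln ?posrE ?powR_gt0 ?power_sum_gt0 //.
  rewrite -[leRHS]mul1r -w_sum1 mulr_suml; apply: ler_sum => i _.
  have := w_ge0 i; rewrite le_eqVlt => /predU1P[<-|wi]; first by rewrite !mul0r.
  rewrite ler_pM2l // /powR !gt_eqF // ler_expR ler_nM2l //.
  by rewrite ler_ln ?posrE // c_min.
(* The other bound keeps only the term of index [i0] in the power sum. *)
rewrite -[X in _ <= X + _](mulKf (negbT (lt_eqF t_lt0))) -mulrDr.
rewrite ler_nM2l ?invr_lt0 //.
rewrite -ln_powR -lnM ?posrE ?powR_gt0 //.
rewrite ler_ln ?posrE ?mulr_gt0 ?powR_gt0 ?power_sum_gt0 //.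
rewrite /power_sum (bigD1 i0) //= mulrC lerDl.
by apply: sumr_ge0 => j _; rewrite mulr_ge0 ?powR_ge0.
Unshelve. all: by end_near. Qed.

End PowerSums.

(** * Limits of the exponent [1 - b^-1] at the orders 0, 1 and infinity *)

Section Exponent.
Local Open Scope classical_set_scope.
Variable R : realType.

Lemma cvg_exponent1 : 1 - b^-1 @[b --> (1 : R)^'] --> (0 : R)^'.
Proof.
have cvg0 : 1 - b^-1 @[b --> (1 : R)] --> (0 : R).
  rewrite -[X in _ --> X](subrr (1 : R)); apply: cvgB; first exact: cvg_cst.
  by rewrite -[X in _ --> X]invr1; apply: cvgV; [exact: oner_neq0 | exact: cvg_id].
(* The target neighbourhood is punctured too: [b != 1] forces [1 - b^-1 != 0]. *)
move=> A /cvg0/nbhs_dnbhs nearA.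
apply: filterS2 nearA (nbhs_dnbhs_neq (1 : R)) => b /= Ab b_neq1; apply: Ab.
by rewrite /= subr_eq0 eq_sym invr_eq1.
Qed.

Lemma cvg_exponent_pinfty : 1 - b^-1 @[b --> +oo%R] --> (1 : R).
Proof.
rewrite -[X in _ --> X]subr0; apply: cvgB; first exact: cvg_cst.
by apply/gtr0_cvgV0; [exact: nbhs_pinfty_gt | exact: cvg_id].
Qed.

Lemma cvg_exponent0 : 1 - b^-1 @[b --> (0 : R)^'+] --> -oo%R.
Proof.
apply: (cvg_comp (fun b : R => b^-1) (fun t : R => 1 - t) (G := +oo%R)).
  apply/gtr0_cvgV0; first by near=> b; rewrite invr_gt0; near: b; exact: nbhs_right_gt.
  suff : b^-1^-1 @[b --> (0 : R)^'+] --> (0 : R) by [].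
  under eq_fun do rewrite invrK.
  exact/cvg_at_right_filter/cvg_id.
apply: cvg_comp (cvg_addrl_Ny 1).
exact/cvgNrNy/cvg_id.
Unshelve. all: by end_near. Qed.

End Exponent.

(** * Existence of the capacities at the limit orders *)

Section Capacity.
Local Open Scope classical_set_scope.
Variables (R : realType) (q : nat) (Y : finType) (W : channel R q Y).
Variables (I : finType) (w c : I -> R).
Hypothesis w_ge0 : forall i, 0 <= w i.
Hypothesis w_sum1 : \sum_i w i = 1.
Hypothesis c_gt0 : forall i, 0 < c i.

Hypothesis capacityE :
  forall a, 0 < a -> capacity_gen W a = scaled_log w c (1 - a^-1).

(** Change of variable [t = 1 - b^-1]. The formula for the capacity is available only for positive
    orders, so [b] has to be eventually positive along [F]. *)
Lemma cvg_capacity_gen (F G : set_system R) :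
    Filter F -> (\forall b \near F, 0 < b) -> 1 - b^-1 @[b --> F] --> G ->
    cvg (scaled_log w c t @[t --> G]) ->
  cvg (capacity_gen W b @[b --> F]).
Proof.
move=> FF F_gt0 cvgFG /cvg_ex[l cvg_l]; apply/cvg_ex; exists l.
have cvg_scaled : scaled_log w c (1 - b^-1) @[b --> F] --> l.
  exact: cvg_comp cvgFG cvg_l.
apply: cvg_trans cvg_scaled.
by apply: near_eq_cvg; near=> b; rewrite capacityE //; near: b.
Unshelve. all: by end_near. Qed.

Lemma cvg_capacity_gen0 : cvg (capacity_gen W b @[b --> (0 : R)^'+]).
Proof.
apply: cvg_capacity_gen (@cvg_exponent0 R) (cvg_scaled_logNy w_ge0 w_sum1 c_gt0).
exact: nbhs_right_gt.
Qed.

Lemma cvg_capacity_gen1 : cvg (capacity_gen W b @[b --> (1 : R)^']).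
Proof.
apply: cvg_capacity_gen (@cvg_exponent1 R) (cvg_scaled_log0 w_ge0 w_sum1 c_gt0).
exact/nbhs_dnbhs/lt_nbhsr.
Qed.

Lemma cvg_capacity_gen_pinfty : cvg (capacity_gen W b @[b --> +oo%R]).
Proof.
apply: cvg_capacity_gen (@cvg_exponent_pinfty R) (cvg_scaled_log1 w_ge0 w_sum1 c_gt0).
exact: nbhs_pinfty_gt.
Qed.

End Capacity.

(** * Pairs of congruences with nested moduli *)

Section Spectra.
Local Open Scope nat_scope.

(** The congruence with the larger modulus fixes [u] modulo the smaller one, directly or through the
    invertible [g]. The other congruence then becomes a compatibility condition free of [u], and
    only the solutions modulo the lcm remain to be counted. *)
Lemma card_affine_joint q d1 d2 g s r1 r2 :
    0 < q -> d1 %| q -> d2 %| q -> coprime g q -> (d1 %| d2) || (d2 %| d1) ->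
  \sum_(u < q) ((s + g * u == r1 %[mod d1]) && (u == r2 %[mod d2])) =
  (s + g * r2 == r1 %[mod gcdn d1 d2]) * (q %/ lcmn d1 d2).
Proof.
move=> q_gt0 d1q d2q gq /orP[d12|d21].
  have /gcdn_idPl -> := d12; have /lcmn_idPl lcmE := d12; rewrite lcmnC lcmE.
  rewrite -(card_affine_mod 0 r2 q_gt0 d2q (coprime1n _)) big_distrr /=.
  apply: eq_bigr => u _; rewrite add0n mul1n.
  have [u_r2|] := eqVneq (u %% d2) (r2 %% d2); last by rewrite andbF muln0.
  rewrite andbT muln1; congr (nat_of_bool (_ == _)).
  have u_r2' : u = r2 %[mod d1] by rewrite -(modn_dvdm u d12) u_r2 modn_dvdm.
  by rewrite -modnDmr -modnMmr u_r2' modnMmr modnDmr.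
have /gcdn_idPr -> := d21; have /lcmn_idPl -> := d21.
have gd1 : coprime g d1 := coprime_dvdr d1q gq.
rewrite -(card_affine_mod s r1 q_gt0 d1q gd1) big_distrr /=.
apply: eq_bigr => u _.
have [u_r1|] := eqVneq ((s + g * u) %% d1) (r1 %% d1); last by rewrite muln0.
rewrite muln1; congr nat_of_bool.
have -> : r1 = s + g * u %[mod d2].
  by rewrite -(modn_dvdm r1 d21) -u_r1 modn_dvdm.
by rewrite eqn_modDl eqn_modMl_coprime ?(coprime_dvdr d2q gq) // eq_sym.
Qed.

End Spectra.

(** * Capacity of the generalized erasure channel *)

Section Channels.
Variables (R : realType) (q : nat).
Hypothesis q_gt0 : (0 < q)%N.

Lemma capacity_genE (Y : finType) (W : channel R q Y) (I : finType)
    (w c : I -> R) a :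
  \sum_y (\sum_(x < q) q%:R^-1 * W x y `^ a) `^ a^-1 =
    power_sum w c (1 - a^-1) ->
  a != 0 -> capacity_gen W a = scaled_log w c (1 - a^-1).
Proof.
rewrite /capacity_gen /scaled_log => -> a_neq0; congr (_ * _).
(* The prefactor [a / (a - 1)] is the inverse of [1 - a^-1], even at [a = 1], where both are 0 by
   the convention [0^-1 = 0]. *)
by rewrite -invf_div mulrBl divff // mul1r.
Qed.

(** In all three channels, the likelihood of a fixed output is a constant times an indicator of the
    input, so its mean of order [a] depends only on the number of admissible inputs. *)
Lemma alpha_mean_indicator (k a : R) (P : pred 'I_q) : 0 <= k -> 0 < a ->
  (\sum_(x < q) q%:R^-1 * (k * (P x)%:R) `^ a) `^ a^-1 =
  k * ((\sum_(x < q) P x)%:R / q%:R) `^ a^-1.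
Proof.
move=> k_ge0 a_gt0.
have -> : \sum_(x < q) q%:R^-1 * (k * (P x)%:R) `^ a =
    k `^ a * ((\sum_(x < q) P x)%:R / q%:R).
  rewrite natr_sum mulr_suml mulr_sumr; apply: eq_bigr => x _.
  case: (P x); first by rewrite mulr1 mulrCA mul1r mulrC.
  by rewrite mulr0 powR0 ?gt_eqF // mul0r !mulr0.
rewrite powRM ?powR_ge0 ?divr_ge0 // -powRrM divff ?gt_eqF // powRr1 //.
Qed.

Lemma natr_quotient d : (d %| q)%N -> (q %/ d)%:R / q%:R = d%:R^-1 :> R.
Proof.
move=> dq; have d_gt0 := dvdn_gt0 q_gt0 dq.
rewrite -[X in _ / X%:R](divnK dq) natrM invfM mulrA divff ?mul1r //.
rewrite pnatr_eq0 -lt0n.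
by rewrite divn_gt0 // dvdn_leq.
Qed.

(** The origin of the exponent [t]: [d] residue classes, each selecting a fraction [d^-1] of the
    inputs, contribute equally. *)
Lemma powR_exponent (d : nat) (a : R) : (0 < d)%N ->
  d%:R * d%:R^-1 `^ a^-1 = d%:R `^ (1 - a^-1) :> R.
Proof.
move=> d_gt0; rewrite powRB; last by rewrite pnatr_eq0 -lt0n d_gt0 implybT.
rewrite powRr1 ?ler0n //; congr (_ * _).
by rewrite -powR_inv1 ?ler0n // -powRrM mulN1r powRN.
Qed.

Lemma divisor_dvdn (d : divisor q) : (ssval d %| q)%N.
Proof. by have := ssvalP d; rewrite -dvdn_divisors. Qed.

Lemma divisor_gt0 (d : divisor q) : (0 < ssval d)%N.
Proof. exact: dvdn_gt0 (divisor_dvdn d). Qed.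

Lemma sum_gec_output (F : divisor q -> R) :
  \sum_(y : gec_output q) F (tag y) = \sum_d (ssval d)%:R * F d.
Proof.
transitivity (\sum_(d : divisor q) \sum_(r < ssval d) F d).
  by rewrite sig_big_dep; apply: eq_bigr => -[].
by apply: eq_bigr => d _; rewrite sumr_const card_ord mulr_natl.
Qed.

Variable eps : divisor q -> R.
Hypothesis eps_ge0 : forall d, 0 <= eps d.
Hypothesis eps_sum1 : \sum_(d : divisor q) eps d = 1.
Let V := gec eps_ge0 eps_sum1.

Lemma gec_transE (x : 'I_q) (y : gec_output q) :
  V x y = eps (tag y) * (x == tagged y %[mod ssval (tag y)])%:R.
Proof.
rewrite /V /= /gec_fun eq_sym [X in _ = _ * (_ == X)%:R]modn_small //.
by case: eqP; rewrite (mulr1, mulr0).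
Qed.

(** The reduction modulo [q] in [polar_map] disappears because the modulus of the output divides
    [q]. *)
Lemma gec_polar_mapE g u1 u2 (y : gec_output q) :
  V (polar_map g u1 u2) y =
  eps (tag y) * (u1 + g * u2 == tagged y %[mod ssval (tag y)])%N%:R.
Proof. by rewrite gec_transE /= modn_dvdm ?divisor_dvdn. Qed.

Lemma capacity_gen_gec a : 0 < a ->
  capacity_gen V a = scaled_log eps (fun d => (ssval d)%:R) (1 - a^-1).
Proof.
move=> a_gt0; apply: capacity_genE; last by rewrite gt_eqF.
transitivity (\sum_(y : gec_output q) eps (tag y) * (ssval (tag y))%:R^-1 `^ a^-1).
  apply: eq_bigr => y _; under eq_bigr do rewrite gec_transE.
  rewrite alpha_mean_indicator //; congr (_ * _ `^ _).
  rewrite -(natr_quotient (divisor_dvdn (tag y))); congr (_%:R / _).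
  rewrite -(card_affine_mod 0 (tagged y) q_gt0 (divisor_dvdn _) (coprime1n _)).
  by apply: eq_bigr => u _; rewrite add0n mul1n.
rewrite (sum_gec_output (fun d => eps d * (ssval d)%:R^-1 `^ a^-1)).
by apply: eq_bigr => d _; rewrite mulrCA powR_exponent ?divisor_gt0.
Qed.

(** * Capacities of the two polarized channels *)

Variable g : 'I_q.
Hypothesis g_coprime : coprime g q.
Hypothesis chain : forall d1 d2 : divisor q,
  (ssval d1 %| ssval d2)%N || (ssval d2 %| ssval d1)%N.

Let gcd_div (d : divisor q * divisor q) := gcdn (ssval d.1) (ssval d.2).
Let lcm_div (d : divisor q * divisor q) := lcmn (ssval d.1) (ssval d.2).
Let eps2 (d : divisor q * divisor q) := eps d.1 * eps d.2.
Let tags (y : gec_output q * gec_output q) := (tag y.1, tag y.2).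

Lemma gcd_div_dvdn d : (gcd_div d %| q)%N.
Proof. exact: dvdn_trans (dvdn_gcdl _ _) (divisor_dvdn _). Qed.

Lemma lcm_div_dvdn d : (lcm_div d %| q)%N.
Proof. by rewrite dvdn_lcm !divisor_dvdn. Qed.

Lemma gcd_div_gt0 d : (0 < gcd_div d)%N.
Proof. exact: dvdn_gt0 (gcd_div_dvdn d). Qed.

Lemma lcm_div_gt0 d : (0 < lcm_div d)%N.
Proof. exact: dvdn_gt0 (lcm_div_dvdn d). Qed.

(** The number of output pairs, a product of two divisors, is written as gcd times lcm: for each
    polarized channel one factor cancels a denominator and the other feeds [powR_exponent]. *)
Lemma sum_gec_output_pair (F : divisor q * divisor q -> R) :
  \sum_y F (tags y) = \sum_d (gcd_div d)%:R * (lcm_div d)%:R * F d.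
Proof.
rewrite -(pair_bigA _ (fun y1 y2 : gec_output q => F (tag y1, tag y2))) /=.
pose G d := (gcd_div d)%:R * (lcm_div d)%:R * F d.
transitivity (\sum_d1 \sum_d2 G (d1, d2)); last first.
  by rewrite pair_bigA; apply: eq_bigr => -[].
under eq_bigr do rewrite (sum_gec_output (fun d => F (tag _, d))).
rewrite (sum_gec_output (fun d1 => \sum_d2 (ssval d2)%:R * F (d1, d2))).
apply: eq_bigr => d1 _; rewrite mulr_sumr; apply: eq_bigr => d2 _.
by rewrite /G mulrA -!natrM [(gcd_div _ * _)%N]mulnC muln_lcm_gcd.
Qed.

Lemma joint_count (u1 : 'I_q) (y : gec_output q * gec_output q) :
  (\sum_(u2 < q)
     ((u1 + g * u2 == tagged y.1 %[mod ssval (tag y.1)]) &&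
      (u2 == tagged y.2 %[mod ssval (tag y.2)])))%N =
  ((u1 + g * tagged y.2 == tagged y.1 %[mod gcd_div (tags y)]) *
   (q %/ lcm_div (tags y)))%N.
Proof. by rewrite card_affine_joint ?divisor_dvdn. Qed.

Lemma compat_count (y : gec_output q * gec_output q) :
  (\sum_(u1 < q) (u1 + g * tagged y.2 == tagged y.1 %[mod gcd_div (tags y)]))%N =
  (q %/ gcd_div (tags y))%N.
Proof.
rewrite -(card_affine_mod (g * tagged y.2) (tagged y.1) q_gt0 (gcd_div_dvdn _)
  (coprime1n _)).
by apply: eq_bigr => u _; rewrite mul1n addnC.
Qed.

(** An output pair reveals [u1] modulo the gcd: every compatible [u1] extends to the same number
    [q %/ lcm] of values [u2], every other [u1] to none. *)
Lemma capacity_gen_polar0 a : 0 < a ->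
  capacity_gen (polar0 g V) a =
  scaled_log eps2 (fun d => (gcd_div d)%:R) (1 - a^-1).
Proof.
move=> a_gt0; apply: capacity_genE; last by rewrite gt_eqF.
transitivity (\sum_y (fun d =>
  eps2 d / (lcm_div d)%:R * (gcd_div d)%:R^-1 `^ a^-1) (tags y)).
  apply: eq_bigr => y _.
  have transE u1 : polar0 g V u1 y = eps2 (tags y) / (lcm_div (tags y))%:R *
      (u1 + g * tagged y.2 == tagged y.1 %[mod gcd_div (tags y)])%N%:R.
    rewrite /= /polar0_fun; under eq_bigr do rewrite gec_polar_mapE gec_transE.
    rewrite -(natr_quotient (lcm_div_dvdn _)) -mulrA [X in _ = _ * X]mulrAC.
    rewrite -natrM mulnC -joint_count natr_sum mulr_suml mulr_sumr.
    by apply: eq_bigr => u2 _; rewrite -mulnb natrM /eps2 /=; ring.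
  under eq_bigr do rewrite transE.
  rewrite alpha_mean_indicator ?divr_ge0 ?mulr_ge0 // compat_count.
  by rewrite natr_quotient ?gcd_div_dvdn.
rewrite (sum_gec_output_pair (fun d =>
  eps2 d / (lcm_div d)%:R * (gcd_div d)%:R^-1 `^ a^-1)).
apply: eq_bigr => d _; rewrite -powR_exponent ?gcd_div_gt0 //.
by field; rewrite pnatr_eq0 -lt0n lcm_div_gt0.
Qed.

(** Once [u1] is known, a possible output reveals [u2] modulo the lcm, and [q %/ gcd] values of [u1]
    are possible for each output pair. *)
Lemma capacity_gen_polar1 a : 0 < a ->
  capacity_gen (polar1 g V) a =
  scaled_log eps2 (fun d => (lcm_div d)%:R) (1 - a^-1).
Proof.
move=> a_gt0; apply: capacity_genE; last by rewrite gt_eqF.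
transitivity (\sum_y (fun d =>
  eps2 d / (gcd_div d)%:R * (lcm_div d)%:R^-1 `^ a^-1) (tags y)).
  rewrite -(pair_bigA _ (fun y u1 =>
     (\sum_(x < q) q%:R^-1 * polar1 g V x (y, u1) `^ a) `^ a^-1)) /=.
  apply: eq_bigr => y _.
  (* Expanding the inverse of the gcd as a count of compatible [u1] over [q] turns the goal into an
     equality term by term in [u1]. *)
  rewrite -(natr_quotient (gcd_div_dvdn _)) -compat_count natr_sum.
  rewrite !(mulr_suml, mulr_sumr).
  apply: eq_bigr => u1 _.
  have transE u2 : polar1_fun g V u2 (y, u1) = q%:R^-1 * eps2 (tags y) *
      ((u1 + g * u2 == tagged y.1 %[mod ssval (tag y.1)]) &&
       (u2 == tagged y.2 %[mod ssval (tag y.2)]))%N%:R.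
    by rewrite /polar1_fun gec_polar_mapE gec_transE -mulnb natrM /eps2 /=; ring.
  under eq_bigr do rewrite transE.
  rewrite alpha_mean_indicator ?mulr_ge0 ?invr_ge0 // joint_count natrM.
  rewrite -mulrA natr_quotient ?lcm_div_dvdn //.
  (* An incompatible [u1] gives an output of probability zero, whose term vanishes since [a^-1] is
     nonzero. *)
  case: eqP => _; first by rewrite !mul1r; ring.
  by rewrite !mul0r powR0 ?invr_eq0 ?gt_eqF // !mulr0 mul0r.
rewrite (sum_gec_output_pair (fun d =>
  eps2 d / (gcd_div d)%:R * (lcm_div d)%:R^-1 `^ a^-1)).
apply: eq_bigr => d _; rewrite -powR_exponent ?lcm_div_gt0 //.
by field; rewrite pnatr_eq0 -lt0n gcd_div_gt0.
Qed.

(** In a chain, gcd and lcm are [d1] and [d2] in some order, so their powers add up to those of [d1]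
    and [d2]; as [eps] sums to 1, each of the two yields one copy of the power sum of [eps]. *)
Lemma power_sum_gcd_lcm t :
  power_sum eps2 (fun d => (gcd_div d)%:R) t +
    power_sum eps2 (fun d => (lcm_div d)%:R) t =
  2 * power_sum eps (fun d => (ssval d)%:R) t.
Proof.
set S := power_sum eps _ t.
transitivity (\sum_d1 \sum_d2
    (eps d1 * eps d2 * ((ssval d1)%:R `^ t + (ssval d2)%:R `^ t))).
  rewrite pair_bigA -big_split /=; apply: eq_bigr => -[d1 d2] _ /=.
  rewrite /eps2 /gcd_div /lcm_div -mulrDr; congr (_ * _) => /=.
  case/orP: (chain d1 d2) => [/[dup]/gcdn_idPl -> /lcmn_idPr ->//|].
  by move=> /[dup]/gcdn_idPr -> /lcmn_idPl ->; rewrite addrC.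
transitivity (\sum_d1 (eps d1 * (ssval d1)%:R `^ t + eps d1 * S)).
  apply: eq_bigr => d1 _.
  have -> : eps d1 * (ssval d1)%:R `^ t =
      \sum_d2 eps d2 * (eps d1 * (ssval d1)%:R `^ t).
    by rewrite -mulr_suml eps_sum1 mul1r.
  by rewrite mulr_sumr -big_split; apply: eq_bigr => d2 _ /=; ring.
by rewrite big_split -mulr_suml eps_sum1 /= -/(power_sum _ _ t) -/S; ring.
Qed.

End Channels.

(** * Divisors of prime powers, and the AM-GM inequality with signs *)

Lemma dvdn_pfactor_total p k d1 d2 : prime p ->
  (d1 %| p ^ k)%N -> (d2 %| p ^ k)%N -> (d1 %| d2)%N || (d2 %| d1)%N.
Proof.
move=> p_pr /(dvdn_pfactor _ _ p_pr)[i _ ->] /(dvdn_pfactor _ _ p_pr)[j _ ->].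
by case/orP: (leq_total i j) => le_ij; rewrite (dvdn_exp2l p le_ij) ?orbT.
Qed.

Lemma ln_amgm (R : realType) (x y z : R) :
  0 < x -> 0 < y -> 0 < z -> x + y = 2 * z -> ln x + ln y <= 2 * ln z.
Proof.
move=> x_gt0 y_gt0 z_gt0 xyz.
rewrite mulr_natl mulr2n -!lnM ?posrE // ler_ln ?posrE ?mulr_gt0 //.
(* With this value of [x], [z * z - x * y] is the square of [z - y]. *)
have -> : x = 2 * z - y by rewrite -xyz addrK.
by rewrite -subr_ge0; have := sqr_ge0 (z - y); lra.
Qed.

Section Sign.
Variables (R : realType) (t S0 S1 S : R).
Hypotheses (S0_gt0 : 0 < S0) (S1_gt0 : 0 < S1) (S_gt0 : 0 < S).
Hypothesis S01 : S0 + S1 = 2 * S.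

Lemma scaled_ln_amgm_le0 : 0 <= t ->
  t^-1 * ln S0 + t^-1 * ln S1 - 2 * (t^-1 * ln S) <= 0.
Proof.
move=> t_ge0; rewrite mulrCA -mulrDr -mulrBr mulr_ge0_le0 ?invr_ge0 //.
by rewrite subr_le0 ln_amgm.
Qed.

Lemma scaled_ln_amgm_ge0 : t <= 0 ->
  0 <= t^-1 * ln S0 + t^-1 * ln S1 - 2 * (t^-1 * ln S).
Proof.
move=> t_le0; rewrite mulrCA -mulrDr -mulrBr mulr_le0 ?invr_le0 //.
by rewrite subr_le0 ln_amgm.
Qed.

End Sign.

(** * The capacity inequalities at all orders *)

Theorem corollary2 (R : realType) (q : nat) (q_ge2 : (2 <= q)%N)
    (q_pp : exists p k : nat, prime p /\ q = (p ^ k)%N)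
    (eps : divisor q -> R) (eps_ge0 : forall d, 0 <= eps d)
    (eps_sum1 : \sum_(d : divisor q) eps d = 1)
    (g : 'I_q) (g_coprime : coprime g q) (alpha : \bar R) :
  let V := gec eps_ge0 eps_sum1 in
  let V0 := polar0 g V in
  let V1 := polar1 g V in
  ((0%:E <= alpha <= 1%:E)%E ->
     capacity alpha V0 + capacity alpha V1 >= 2 * capacity alpha V) /\
  ((1%:E <= alpha <= +oo)%E ->
     capacity alpha V0 + capacity alpha V1 <= 2 * capacity alpha V).
Proof.
move=> V V0 V1.
have q_gt0 : (0 < q)%N := ltnW q_ge2.
have chain (d1 d2 : divisor q) :
    (ssval d1 %| ssval d2)%N || (ssval d2 %| ssval d1)%N.
  have [p [k [p_pr qE]]] := q_pp; apply: (@dvdn_pfactor_total p k) => //.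
    by rewrite -qE divisor_dvdn.
  by rewrite -qE divisor_dvdn.
pose e2 (d : divisor q * divisor q) := eps d.1 * eps d.2.
pose cgcd (d : divisor q * divisor q) : R := (gcdn (ssval d.1) (ssval d.2))%:R.
pose clcm (d : divisor q * divisor q) : R := (lcmn (ssval d.1) (ssval d.2))%:R.
pose c (d : divisor q) : R := (ssval d)%:R.
have e2_ge0 d : 0 <= e2 d by rewrite mulr_ge0.
have e2_sum1 : \sum_d e2 d = 1.
  rewrite -(pair_bigA _ (fun d1 d2 => eps d1 * eps d2)) /=.
  by under eq_bigr do rewrite -mulr_sumr eps_sum1 mulr1.
have c_gt0 d : 0 < c d by rewrite ltr0n divisor_gt0.
have cgcd_gt0 d : 0 < cgcd d by rewrite ltr0n gcd_div_gt0.
have clcm_gt0 d : 0 < clcm d by rewrite ltr0n lcm_div_gt0.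
have VE := capacity_gen_gec q_gt0 eps_ge0 eps_sum1.
have V0E := capacity_gen_polar0 q_gt0 eps_ge0 eps_sum1 g_coprime chain.
have V1E := capacity_gen_polar1 q_gt0 eps_ge0 eps_sum1 g_coprime chain.
have S_gt0 := power_sum_gt0 eps_ge0 eps_sum1 c_gt0.
have S0_gt0 := power_sum_gt0 e2_ge0 e2_sum1 cgcd_gt0.
have S1_gt0 := power_sum_gt0 e2_ge0 e2_sum1 clcm_gt0.
have S01 := power_sum_gcd_lcm eps_sum1 chain.
(* The sign of [D] is found at the orders in (0, 1) and above 1, then passed to the limit at 0, 1
   and infinity. *)
pose D b := capacity_gen V0 b + capacity_gen V1 b - 2 * capacity_gen V b.
have D_ge0 b : 0 < b -> b < 1 -> 0 <= D b.
  move=> b_gt0 b_lt1; rewrite /D VE // V0E // V1E //.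
  apply: scaled_ln_amgm_ge0 => //.
  by rewrite subr_le0 invf_ge1 // ltW.
have D_le0 b : 1 < b -> D b <= 0.
  move=> b_gt1; have b_gt0 : 0 < b := lt_trans ltr01 b_gt1.
  rewrite /D VE // V0E // V1E //; apply: scaled_ln_amgm_le0 => //.
  by rewrite subr_ge0 invf_le1 // ltW.
have D_cvg (F : set_system R) (l l0 l1 : R) : Filter F ->
    (capacity_gen V0 b @[b --> F] --> l0)%classic ->
    (capacity_gen V1 b @[b --> F] --> l1)%classic ->
    (capacity_gen V b @[b --> F] --> l)%classic ->
    (D b @[b --> F] --> l0 + l1 - 2 * l)%classic.
  move=> FF cvg0 cvg1 cvgV.
  apply: cvgB; first exact: cvgD.
  by apply: cvgM => //; exact: cvg_cst.
have D_cvg0 : (D b @[b --> (0 : R)^'+] -->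
    capacity 0%:E V0 + capacity 0%:E V1 - 2 * capacity 0%:E V)%classic.
  rewrite /capacity eqxx; apply: D_cvg.
  - exact: (cvg_capacity_gen0 e2_ge0 e2_sum1 cgcd_gt0 V0E).
  - exact: (cvg_capacity_gen0 e2_ge0 e2_sum1 clcm_gt0 V1E).
  - exact: (cvg_capacity_gen0 eps_ge0 eps_sum1 c_gt0 VE).
have D_cvg1 : (D b @[b --> (1 : R)^'] -->
    capacity 1%:E V0 + capacity 1%:E V1 - 2 * capacity 1%:E V)%classic.
  rewrite /capacity oner_eq0 eqxx; apply: D_cvg.
  - exact: (cvg_capacity_gen1 e2_ge0 e2_sum1 cgcd_gt0 V0E).
  - exact: (cvg_capacity_gen1 e2_ge0 e2_sum1 clcm_gt0 V1E).
  - exact: (cvg_capacity_gen1 eps_ge0 eps_sum1 c_gt0 VE).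
have D_cvgy : (D b @[b --> +oo%R] -->
    capacity +oo%E V0 + capacity +oo%E V1 - 2 * capacity +oo%E V)%classic.
  rewrite /capacity; apply: D_cvg.
  - exact: (cvg_capacity_gen_pinfty e2_ge0 e2_sum1 cgcd_gt0 V0E).
  - exact: (cvg_capacity_gen_pinfty e2_ge0 e2_sum1 clcm_gt0 V1E).
  - exact: (cvg_capacity_gen_pinfty eps_ge0 eps_sum1 c_gt0 VE).
split=> /andP[].
- rewrite -subr_ge0; case: alpha => [a| |] //; rewrite !lee_fin.
  rewrite le_eqVlt => /predU1P[<- _|a_gt0].
    apply: cvgr_to_ge D_cvg0 _; near=> b; apply: D_ge0; near: b.
      exact: nbhs_right_gt.
    exact: nbhs_right_lt.
  rewrite le_eqVlt => /predU1P[->|a_lt1].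
    (* The two-sided limit at order 1 is approached from the left, where [D] is nonnegative; the
       second half of the theorem approaches it from the right. *)
    apply: cvgr_to_ge (cvg_dnbhs_at_left D_cvg1) _.
    near=> b; apply: D_ge0; near: b; first exact: nbhs_left_gt.
    exact: nbhs_left_lt.
  by rewrite /capacity (gt_eqF a_gt0) (lt_eqF a_lt1); exact: D_ge0.
- rewrite -subr_le0; case: alpha => [a| |] //; rewrite ?lee_fin.
    rewrite le_eqVlt => /predU1P[<- _|a_gt1 _].
      apply: cvgr_to_le (cvg_dnbhs_at_right D_cvg1) _.
      by near=> b; apply: D_le0; near: b; exact: nbhs_right_gt.
    rewrite /capacity (gt_eqF a_gt1) gt_eqF ?(lt_trans ltr01) //.
    exact: D_le0.
  move=> _ _; apply: cvgr_to_le D_cvgy _.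
  by near=> b; apply: D_le0; near: b; exact: nbhs_pinfty_gt.
Unshelve. all: by end_near. Qed.
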